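(* Let $h_0>0$ and $\beta_1>0$ be such that for all $h\le h_0$, $\sup_{\mathbf{v}\in\mathring{\mathbf{V}}_h\setminus\{0\}}\int_{\Omega_h}(\operatorname{div}\mathbf{v})q\,dx/\|\nabla\mathbf{v}\|_{L^2(\Omega_h)}\ge\beta_1\|q\|_{L^2(\Omega_h)}$ for all $q\in\mathring{Q}_h$, and let $\beta_2>0$ be such that $\sup_{\mathbf{v}\in\mathbf{V}_h\setminus\{0\}}\int_{\partial\Omega_h}(\mathbf{v}\cdot\mathbf{n}_h)\mu\,ds/\|\mathbf{v}\|_{1,h}\ge\beta_2\|\mu\|_{-1/2,h}$ for all $\mu\in\mathring{X}_h$. Then there exists $\beta>0$ depending only on $\beta_1$ and $\beta_2$ such that for all $h\le h_0$, \[ \beta\|(q,\mu)\|\le\sup_{\mathbf{v}\in\mathbf{V}_h\setminus\{0\}}\frac{b_h(\mathbf{v},(q,\mu))}{\|\mathbf{v}\|_{1,h}}\qquad\forall(q,\mu)\in\mathring{Q}_h\times\mathring{X}_h . \]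
   Context: $\Omega\subset\mathbb{R}^2$ bounded with smooth boundary; $S\supset\Omega$ a polygon with quasi-uniform shape-regular triangulation $\mathcal{S}_h$ of mesh size $h$; $\mathcal{T}_h=\{T\in\mathcal{S}_h:\bar T\subset\bar\Omega\}$, $\Omega_h=\operatorname{int}(\bigcup_{T\in\mathcal{T}_h}\bar T)$; $\mathcal{T}_h^{ct}$ its Clough–Tocher refinement; $\mathcal{E}_h^B$ boundary edges, $\mathbf{n}_h$ outward normal of $\partial\Omega_h$, $h_e=\operatorname{diam}e$, $\int_{\partial\Omega_h}q=\sum_{e\in\mathcal{E}_h^B}\int_e q$. Spaces: $\mathbf{V}_h=\{\mathbf{v}\in\mathbf{H}^1(\Omega_h):\mathbf{v}|_K\in\mathcal{P}_2(K)^2\ \forall K\in\mathcal{T}_h^{ct},\ \int_{\partial\Omega_h}\mathbf{v}\cdot\mathbf{n}_h=0\}$, $\mathring{\mathbf{V}}_h=\mathbf{V}_h\cap\mathbf{H}^1_0(\Omega_h)$; $\mathring{Q}_h$ = discontinuous piecewise $\mathcal{P}_1$ functions on $\mathcal{T}_h^{ct}$ with zero mean on $\Omega_h$; $\mathring{X}_h=\{\mu\in C(\partial\Omega_h):\mu|_e\in\mathcal{P}_2(e)\ \forall e,\ \int_{\partial\Omega_h}\mu=0\}$. $b_h(\mathbf{v},(q,\mu))=-\int_{\Omega_h}(\operatorname{div}\mathbf{v})q\,dx+\int_{\partial\Omega_h}(\mathbf{v}\cdot\mathbf{n}_h)\mu\,ds$. Norms: $\|\mathbf{v}\|_{1,h}^2=\|\nabla\mathbf{v}\|_{L^2(\Omega_h)}^2+\sum_e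 h_e^{-1}\|\mathbf{v}\|_{L^2(e)}^2$; $\|\mu\|_{-1/2,h}^2=\sum_e h_e\|\mu\|_{L^2(e)}^2$; $\|(q,\mu)\|=\|q\|_{L^2(\Omega_h)}+\|\mu\|_{-1/2,h}$. (Such $h_0,\beta_1,\beta_2$ independent of $h$ exist.) *)

(* Defs.v *)
From HB Require Import structures.
From mathcomp Require Import all_boot all_order all_algebra.
From mathcomp Require Import all_classical all_reals all_analysis.
Set Implicit Arguments. Unset Strict Implicit. Unset Printing Implicit Defensive.
Import Order.TTheory GRing.Theory Num.Theory numFieldNormedType.Exports.
Local Open Scope classical_set_scope.
Local Open Scope ring_scope.

Section FEM.
Variable R : realType.

Definition pt := (R * R)%type.
Definition padd (p q : pt) : pt := (p.1 + q.1, p.2 + q.2).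
Definition psub (p q : pt) : pt := (p.1 - q.1, p.2 - q.2).
Definition pscale (a : R) (p : pt) : pt := (a * p.1, a * p.2).
Definition pdot (p q : pt) : R := p.1 * q.1 + p.2 * q.2.
Definition enorm (p : pt) : R := Num.sqrt (pdot p p).
Definition eball (x : pt) (r : R) : set pt := [set y | enorm (psub y x) < r].

Definition tri := (pt * pt * pt)%type.
Definition tA (T : tri) : pt := T.1.1.
Definition tB (T : tri) : pt := T.1.2.
Definition tC (T : tri) : pt := T.2.
Definition verts (T : tri) : seq pt := [:: tA T; tB T; tC T].

Definition det2 (T : tri) : R :=
  let u := psub (tB T) (tA T) in let w := psub (tC T) (tA T) in
  u.1 * w.2 - u.2 * w.1.
Definition area (T : tri) : R := `|det2 T| / 2.
Definition perimeter (T : tri) : R :=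
  enorm (psub (tB T) (tA T)) + enorm (psub (tC T) (tB T)) + enorm (psub (tA T) (tC T)).
Definition diam (T : tri) : R :=
  Num.max (enorm (psub (tB T) (tA T)))
    (Num.max (enorm (psub (tC T) (tB T))) (enorm (psub (tA T) (tC T)))).
Definition inradius (T : tri) : R := 2 * area T / perimeter T.

(* convex hull of a finite list of points (empty list -> empty set) *)
Definition conv (s : seq pt) : set pt :=
  [set x | exists lam : pt -> R, (forall p, p \in s -> 0 <= lam p) /\
     \sum_(p <- s) lam p = 1 /\
     x = (\sum_(p <- s) lam p * p.1, \sum_(p <- s) lam p * p.2)].

Definition ctri (T : tri) : set pt := conv (verts T).
Definition otri (T : tri) : set pt :=
  [set x | exists a b c : R, 0 < a /\ 0 < b /\ 0 < c /\ a + b + c = 1 /\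
     x = padd (pscale a (tA T)) (padd (pscale b (tB T)) (pscale c (tC T)))].

(* conforming triangulation: nondegenerate triangles, no repetitions, and two
   distinct closed triangles intersect exactly in the convex hull of their common
   vertices (empty, a common vertex, or a common edge) *)
Definition conforming (Th : seq tri) : Prop :=
  uniq Th /\
  (forall T, T \in Th -> det2 T != 0) /\
  (forall T T', T \in Th -> T' \in Th -> T != T' ->
     ctri T `&` ctri T' = conv [seq p <- verts T | p \in verts T']).

Definition region (Th : seq tri) : set pt := \bigcup_(T in [set T | T \in Th]) ctri T.
Definition Omegah (Th : seq tri) : set pt := interior (region Th).

Definition meshsize_is (Th : seq tri) (h : R) : Prop :=
  (forall T, T \in Th -> diam T <= h) /\ (exists2 T, T \in Th & diam T = h).

Definition barycenter (T : tri) : pt :=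
  pscale (3%:R^-1) (padd (tA T) (padd (tB T) (tC T))).
Definition ct_split (T : tri) : seq tri :=
  [:: (tA T, tB T, barycenter T); (tB T, tC T, barycenter T);
      (tC T, tA T, barycenter T)].
Definition ct_refine (Th : seq tri) : seq tri := flatten (map ct_split Th).

(* edges: (p, q, r) = edge [p,q] of a triangle with opposite vertex r *)
Definition edge := (pt * pt * pt)%type.
Definition edges (T : tri) : seq edge :=
  [:: (tA T, tB T, tC T); (tB T, tC T, tA T); (tC T, tA T, tB T)].
Definition is_bedge (Th : seq tri) (T : tri) (e : edge) : bool :=
  ~~ has (fun T' => (T' != T) && (e.1.1 \in verts T') && (e.1.2 \in verts T')) Th.
(* boundary edges of Omega_h, each listed once (with its unique triangle) *)
Definition bedges (Th : seq tri) : seq edge :=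
  flatten [seq [seq e <- edges T | is_bedge Th T e] | T <- Th].

Definition elen (e : edge) : R := enorm (psub e.1.2 e.1.1).
Definition epar (e : edge) (t : R) : pt := padd e.1.1 (pscale t (psub e.1.2 e.1.1)).
(* unit outward normal: orthogonal to the edge, pointing away from the opposite vertex *)
Definition enormal (e : edge) : pt :=
  let d := psub e.1.2 e.1.1 in
  let m := (d.2, - d.1) in
  let s : R := if pdot m (psub e.2 e.1.1) < 0 then 1 else -1 in
  pscale (s / enorm d) m.
Definition closed_edge (e : edge) : set pt := [set epar e t | t in `[0, 1]%classic].

Definition leb := (@lebesgue_measure R).
Definition leb2 := (leb \x leb)%E.
Definition intOh (Th : seq tri) (f : pt -> R) : R := (\int[leb2]_(x in Omegah Th) f x)%R.
Definition int_edge (e : edge) (f : pt -> R) : R :=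
  elen e * (\int[leb]_(t in `[0, 1]%classic) f (epar e t))%R.
Definition int_bd (Th : seq tri) (f : pt -> R) : R :=
  \sum_(e <- bedges Th) int_edge e f.
Definition int_bd_w (Th : seq tri) (w : edge -> R) (f : pt -> R) : R :=
  \sum_(e <- bedges Th) w e * int_edge e f.
Definition flux (Th : seq tri) (v : pt -> pt) (mu : pt -> R) : R :=
  \sum_(e <- bedges Th) int_edge e (fun x => pdot (v x) (enormal e) * mu x).

Definition d1 (g : pt -> R) (x : pt) : R := derive1 (fun t => g (t, x.2)) x.1.
Definition d2 (g : pt -> R) (x : pt) : R := derive1 (fun t => g (x.1, t)) x.2.
Definition comp1 (v : pt -> pt) : pt -> R := fun x => (v x).1.
Definition comp2 (v : pt -> pt) : pt -> R := fun x => (v x).2.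
Definition divv (v : pt -> pt) (x : pt) : R := d1 (comp1 v) x + d2 (comp2 v) x.
Definition gradsq (v : pt -> pt) (x : pt) : R :=
  d1 (comp1 v) x ^+ 2 + d2 (comp1 v) x ^+ 2 + d1 (comp2 v) x ^+ 2 + d2 (comp2 v) x ^+ 2.

Definition L2norm (Th : seq tri) (q : pt -> R) : R := Num.sqrt (intOh Th (fun x => q x ^+ 2)).
Definition gradnorm (Th : seq tri) (v : pt -> pt) : R := Num.sqrt (intOh Th (gradsq v)).
Definition norm1h (Th : seq tri) (v : pt -> pt) : R :=
  Num.sqrt (intOh Th (gradsq v) +
            int_bd_w Th (fun e => (elen e)^-1) (fun x => pdot (v x) (v x))).
Definition normm12h (Th : seq tri) (mu : pt -> R) : R :=
  Num.sqrt (int_bd_w Th elen (fun x => mu x ^+ 2)).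
Definition normQX (Th : seq tri) (q mu : pt -> R) : R := L2norm Th q + normm12h Th mu.

Definition isP2_on (A : set pt) (g : pt -> R) : Prop :=
  exists c0 c1 c2 c3 c4 c5 : R, forall x, A x ->
    g x = c0 + c1 * x.1 + c2 * x.2 + c3 * x.1 ^+ 2 + c4 * (x.1 * x.2) + c5 * x.2 ^+ 2.
Definition isP1_on (A : set pt) (g : pt -> R) : Prop :=
  exists c0 c1 c2 : R, forall x, A x -> g x = c0 + c1 * x.1 + c2 * x.2.

Definition int_bd_vn (Th : seq tri) (v : pt -> pt) : R :=
  \sum_(e <- bedges Th) int_edge e (fun x => pdot (v x) (enormal e)).

Definition nonzero_on {V : Type} (A : set pt) (z : V) (v : pt -> V) : Prop :=
  exists2 x, A x & v x <> z.

(* V_h: continuous piecewise P2 on the Clough--Tocher refinement (continuity is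
   automatic since v is a single function agreeing with a polynomial on each closed
   subtriangle; such functions are in H^1(Omega_h)), with zero total flux *)
Definition Vh (Th : seq tri) : set (pt -> pt) :=
  [set v | (forall K, K \in ct_refine Th ->
               isP2_on (ctri K) (comp1 v) /\ isP2_on (ctri K) (comp2 v)) /\
           int_bd_vn Th v = 0].
Definition Vh0 (Th : seq tri) : set (pt -> pt) :=
  [set v | Vh Th v /\ forall e, e \in bedges Th -> forall x, closed_edge e x -> v x = (0, 0)].
(* Q_h: discontinuous piecewise P1 on the refinement, zero mean on Omega_h *)
Definition Qh0 (Th : seq tri) : set (pt -> R) :=
  [set q | (forall K, K \in ct_refine Th -> isP1_on (otri K) q) /\ intOh Th q = 0].
(* X_h: continuous piecewise P2 on boundary edges, zero mean on the boundary *)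
Definition Xh0 (Th : seq tri) : set (pt -> R) :=
  [set mu | (forall e, e \in bedges Th -> exists c0 c1 c2 : R,
                forall t, 0 <= t <= 1 -> mu (epar e t) = c0 + c1 * t + c2 * t ^+ 2) /\
            int_bd Th mu = 0].

Definition bh (Th : seq tri) (v : pt -> pt) (q mu : pt -> R) : R :=
  - intOh Th (fun x => divv v x * q x) + flux Th v mu.

Definition sup_div (Th : seq tri) (q : pt -> R) : R :=
  sup [set (intOh Th (fun x => divv v x * q x)) / gradnorm Th v
      | v in [set v | Vh0 Th v /\ nonzero_on (Omegah Th) (0, 0) v]].
Definition sup_bd (Th : seq tri) (mu : pt -> R) : R :=
  sup [set flux Th v mu / norm1h Th v
      | v in [set v | Vh Th v /\ nonzero_on (Omegah Th) (0, 0) v]].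
Definition sup_bh (Th : seq tri) (q mu : pt -> R) : R :=
  sup [set bh Th v q mu / norm1h Th v
      | v in [set v | Vh Th v /\ nonzero_on (Omegah Th) (0, 0) v]].

Definition rot (th : R) (p : pt) : pt := (cos th * p.1 - sin th * p.2, sin th * p.1 + cos th * p.2).
Definition smooth_fun (phi : R -> R) : Prop :=
  forall n t, derivable (iter n (fun g => derive1 g) phi) t 1.
Definition smooth_domain (Om : set pt) : Prop :=
  open Om /\ (exists M : R, forall y, Om y -> enorm y <= M) /\
  forall x, (closure Om `\` Om) x ->
    exists r th (phi : R -> R), 0 < r /\ smooth_fun phi /\
      Om `&` eball x r = [set y | eball x r y /\
                           let z := rot th (psub y x) in z.2 < phi z.1].

Definition Th_of (Om : set pt) (Sh : seq tri) : seq tri :=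
  [seq T <- Sh | `[< ctri T `<=` closure Om >]].

Definition admissible_family (Om : set pt) (H : set R) (Sh : R -> seq tri) : Prop :=
  (exists S : set pt, Om `<=` S /\ forall h, H h -> region (Sh h) = S) /\
  (forall h, H h -> 0 < h /\ conforming (Sh h) /\ meshsize_is (Sh h) h) /\
  (exists sigma : R, 0 < sigma /\
     forall h T, H h -> T \in Sh h -> diam T <= sigma * inradius T) /\
  (exists rho : R, 0 < rho /\ forall h T, H h -> T \in Sh h -> rho * h <= diam T).

End FEM.

(* Main.v *)
(** The proof tests b_h(., (q, mu)) twice. With -v for v vanishing on the
    boundary the flux term drops out, so beta1 |q| <= S, S being the supremum
    to be bounded below. For arbitrary v the flux is b_h plus the divergence
    term, which is at most 2 |v|_{1,h} |q|, so beta2 |mu| <= S + 2 |q|. Together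
    these give beta = beta1 beta2 / (beta1 + beta2 + 2).

    As [sup] is 0 on unbounded sets, the quotients must also be shown to be
    bounded above, by Cauchy-Schwarz inside and on the boundary. Partial
    derivatives are only known on the open subtriangles; the rest of Omega_h
    lies on finitely many lines, hence is negligible. *)

Require Import Defs.
From HB Require Import structures.
From mathcomp Require Import all_boot all_order all_algebra.
From mathcomp Require Import all_classical all_reals all_analysis.
From mathcomp Require Import measurable_realfun ring lra.
Set Implicit Arguments. Unset Strict Implicit. Unset Printing Implicit Defensive.
Import Order.TTheory GRing.Theory Num.Theory numFieldNormedType.Exports.
Local Open Scope classical_set_scope.
Local Open Scope ring_scope.

(** * Integrals of arbitrary functions do not see null sets *)

Section null_sets.
Import HBSimple HBNNSimple.
Context {d : measure_display} {T : measurableType d} {R : realType}.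
Variable mu : {measure set T -> \bar R}.

(* No measurability of [f] and [g] is needed: multiplying a simple function below
   [f] by the indicator of the complement of [N] keeps its integral and puts it
   below [g]. *)
Lemma ge0_le_integral_off_null (f g : T -> \bar R) (N : set T) :
  measurable N -> mu N = 0%E ->
  (forall x, 0 <= f x)%E -> (forall x, 0 <= g x)%E ->
  (forall x, ~ N x -> f x = g x) ->
  (\int[mu]_x f x <= \int[mu]_x g x)%E.
Proof.
move=> mN N0 f0 g0 fg; rewrite !ge0_integralTE//.
apply: ge_ereal_sup => _ [h /= hf <-].
apply: le_ereal_sup_tmp.
pose h' := proj_nnsfun h (measurableC mN).
have h'E : h' = h \_ (~` N) :> (T -> R) by rewrite (mrestrict _ (measurableC mN)).
have h'g x : ((h' x)%:E <= g x)%E.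
  rewrite h'E patchE; case: ifPn => [xN|_]; last exact: g0.
  by rewrite -fg//; exact: set_mem xN.
exists (sintegral mu h'); first by exists h'.
rewrite -!integralT_nnsfun.
rewrite (@ge0_ae_eq_integral _ _ _ mu setT (EFin \o h) (EFin \o h'))//.
- by apply/measurable_EFinP; exact: measurable_funPT.
- by apply/measurable_EFinP; exact: measurable_funPT.
- by move=> x _; rewrite [leRHS]/comp lee_fin fun_ge0.
- by move=> x _; rewrite [leRHS]/comp lee_fin fun_ge0.
exists N; split => // x /= /not_implyP[_ hh'].
apply: contrapT => xN; apply: hh'.
have h'x : h' x = h x by rewrite h'E patchE mem_set.
exact: (congr1 EFin (esym h'x)).
Qed.

(** The positive and negative parts agree off [N] as well, and each pair is compared in both
    directions. *)
Lemma integral_off_null (f g : T -> \bar R) (N : set T) :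
  measurable N -> mu N = 0%E -> (forall x, ~ N x -> f x = g x) ->
  (\int[mu]_x f x = \int[mu]_x g x)%E.
Proof.
move=> mN N0 fg; rewrite integralE [RHS]integralE; congr (_ - _)%E;
  apply/eqP; rewrite eq_le; apply/andP; split;
  apply: (ge0_le_integral_off_null mN N0) => // x xN;
  by rewrite ?funeposE ?funenegE fg.
Qed.

(** Extension by zero turns both sides into integrals over the whole space, of functions that differ
    at most on [N]. *)
Lemma Rintegral_off_null (D D' : set T) (f : T -> R) (N : set T) :
  measurable N -> mu N = 0%E -> D' `<=` D -> D `\` D' `<=` N ->
  \int[mu]_(x in D) f x = \int[mu]_(x in D') f x.
Proof.
move=> mN N0 sD DN; rewrite Rintegral_mkcond [RHS]Rintegral_mkcond.
rewrite /Rintegral; congr fine; apply: (integral_off_null mN N0) => x xN.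
congr EFin; rewrite !patchE; have [xD'|xD'] := boolP (x \in D').
  by rewrite mem_set//; exact/sD/set_mem.
case: ifPn => // xD; exfalso; apply/xN/DN; split; first exact/set_mem.
by move/mem_set; apply/negP.
Qed.

(* Holds without integrability because [fine] sends both infinities to 0. *)
Lemma RintegralN (D : set T) (f : T -> R) :
  \int[mu]_(x in D) - f x = - \int[mu]_(x in D) f x.
Proof.
rewrite /Rintegral integralE [in RHS]integralE.
have -> : ((fun x => (- f x)%:E) ^\+ = (fun x => (f x)%:E) ^\- :> (T -> \bar R))%E.
  by apply/funext => x; rewrite funeposE funenegE EFinN.
have -> : ((fun x => (- f x)%:E) ^\- = (fun x => (f x)%:E) ^\+ :> (T -> \bar R))%E.
  by apply/funext => x; rewrite funeposE funenegE EFinN oppeK.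
by case: (integral _ _ _) => [a| |]; case: (integral _ _ _) => [b| |] //=;
  rewrite ?oppr0// opprB.
Qed.

End null_sets.

(** * Bounded measurable functions on sets of finite measure *)

Section bounded_measurable.
Context {d : measure_display} {T : measurableType d} {R : realType}.
Implicit Types (D : set T) (f g : T -> R).

(** Unlike integrability, this class is closed under products, so the integrability of every
    polynomial integrand follows from its factors. *)
Definition bmeas D f :=
  measurable_fun D f /\ exists M, forall x, D x -> `|f x| <= M.

Lemma bmeas_cst D (c : R) : bmeas D (fun=> c).
Proof. by split; [exact: measurable_cst | exists `|c|]. Qed.

Lemma bmeasD D f g : bmeas D f -> bmeas D g -> bmeas D (fun x => f x + g x).
Proof.
move=> [mf [M fM]] [mg [K gK]]; split; first exact: measurable_funD.
by exists (M + K) => x Dx; rewrite (le_trans (ler_normD _ _))// lerD ?fM ?gK.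
Qed.

Lemma bmeasM D f g : bmeas D f -> bmeas D g -> bmeas D (fun x => f x * g x).
Proof.
move=> [mf [M fM]] [mg [K gK]]; split; first exact: measurable_funM.
by exists (M * K) => x Dx; rewrite normrM ler_pM ?fM ?gK.
Qed.

Lemma bmeasX2 D f : bmeas D f -> bmeas D (fun x => f x ^+ 2).
Proof.
by move=> bf; under eq_fun do rewrite expr2; exact: bmeasM.
Qed.

Lemma bmeas_eq D f g : (forall x, D x -> f x = g x) -> bmeas D f -> bmeas D g.
Proof.
move=> fg [mf [M fM]]; split.
  by apply: eq_measurable_fun mf => x /set_mem; exact: fg.
by exists M => x Dx; rewrite -fg// fM.
Qed.

Lemma bmeas_set0 f : bmeas set0 f.
Proof. by split; [exact: measurable_fun_set0 | exists 0]. Qed.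

Lemma bmeasU D D' f : measurable D -> measurable D' ->
  bmeas D f -> bmeas D' f -> bmeas (D `|` D') f.
Proof.
move=> mD mD' [mf [M fM]] [mf' [M' fM']]; split.
  by apply/measurable_funU.
exists (Num.max M M') => x [Dx|Dx]; rewrite le_max.
  by rewrite fM.
by rewrite fM' ?orbT.
Qed.

Variable mu : {measure set T -> \bar R}.
Variable D : set T.
Hypotheses (mD : measurable D) (Doo : (mu D < +oo)%E).

Lemma bmeas_integrable f : bmeas D f -> mu.-integrable D (EFin \o f).
Proof.
move=> [mf [M fM]]; apply: measurable_bounded_integrable => //.
exists M; split; first exact: num_real.
by move=> x Mx y /= Dy; rewrite (le_trans (fM _ Dy))// ltW.
Qed.

Lemma bmeas_RintegralD f g : bmeas D f -> bmeas D g ->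
  \int[mu]_(x in D) (f x + g x) = \int[mu]_(x in D) f x + \int[mu]_(x in D) g x.
Proof. by move=> bf bg; rewrite RintegralD//; exact: bmeas_integrable. Qed.

Lemma bmeas_RintegralZ (c : R) f : bmeas D f ->
  \int[mu]_(x in D) (c * f x) = c * \int[mu]_(x in D) f x.
Proof. by move=> bf; rewrite RintegralZl//; exact: bmeas_integrable. Qed.

(** Pulls the parameter [s] out of the integral, giving the quadratic polynomial that
    [discriminant_bound] takes. *)
Lemma bmeas_Rintegral_quad f g k (s : R) : bmeas D f -> bmeas D g -> bmeas D k ->
  \int[mu]_(x in D) (s ^+ 2 * f x + 2 * s * g x + k x) =
  s ^+ 2 * \int[mu]_(x in D) f x + 2 * s * \int[mu]_(x in D) g x
  + \int[mu]_(x in D) k x.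
Proof.
move=> bf bg bk.
have bsf : bmeas D (fun x => s ^+ 2 * f x) by apply: bmeasM => //; exact: bmeas_cst.
have bsg : bmeas D (fun x => 2 * s * g x) by apply: bmeasM => //; exact: bmeas_cst.
by rewrite bmeas_RintegralD ?bmeas_RintegralD ?bmeas_RintegralZ//; exact: bmeasD.
Qed.

End bounded_measurable.

(** The source of every Cauchy-Schwarz inequality below: a quadratic that is nowhere negative has
    nonpositive discriminant. In this form it applies directly to integrals and to weighted sums of
    integrals. *)
Lemma discriminant_bound {R : rcfType} (a b c : R) : 0 <= a -> 0 <= c ->
  (forall s, 0 <= s ^+ 2 * a + 2 * s * b + c) ->
  `|b| <= Num.sqrt a * Num.sqrt c.
Proof.
move=> a0 c0 H; rewrite -sqrtrM// -sqrtr_sqr ler_sqrt ?mulr_ge0//.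
have [a00|an0] := eqVneq a 0.
  have [->|b0] := eqVneq b 0; first by rewrite expr0n mulr_ge0.
  (* If [a = 0] and [b] is nonzero, the polynomial is affine in [s] and takes the value -1 at this
     point. *)
  have := H (- (c + 1) / (2 * b)); rewrite a00 mulr0 add0r.
  have -> : 2 * (- (c + 1) / (2 * b)) * b + c = -1 by field.
  by rewrite oppr_ge0 ler10.
have ap : 0 < a by rewrite lt_neqAle eq_sym an0.
(* The minimiser of the quadratic. *)
have := H (- b / a).
have -> : (- b / a) ^+ 2 * a + 2 * (- b / a) * b + c = (a * c - b ^+ 2) / a.
  by field.
by rewrite pmulr_lge0 ?invr_gt0// subr_ge0.
Qed.

(** * Affine functions on the plane and their zero sets *)

Section affine.
Variable R : realType.
Implicit Types (L : pt R -> R) (x p : pt R).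

Notation mpt := (measurableTypeR R * measurableTypeR R)%type.

Lemma measurable_fun_P1 L : isP1_on setT L ->
  measurable_fun (setT : set mpt) L.
Proof.
move=> [c0 [c1 [c2 LE]]].
apply: (@eq_measurable_fun _ _ mpt _ setT
  (fun x => c0 + c1 * x.1 + c2 * x.2)) => [x _|]; first by rewrite LE.
by apply: measurable_funD; [apply: measurable_funD; [exact: measurable_cst|]|];
  apply: measurable_funM; [exact: measurable_cst|exact: measurable_fst
   |exact: measurable_cst|exact: measurable_snd].
Qed.

Lemma measurable_P1_eq0 L : isP1_on setT L ->
  measurable ([set x | L x = 0] : set mpt).
Proof.
move=> /measurable_fun_P1 mL; rewrite -[X in measurable X]setTI.
exact: (mL measurableT [set 0] (measurable_set1 _)).
Qed.

Lemma measurable_P1_gt0 L : isP1_on setT L ->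
  measurable ([set x | 0 < L x] : set mpt).
Proof.
move=> /measurable_fun_P1 mL; rewrite -[X in measurable X]setTI.
have -> : [set x | 0 < L x] = L @^-1` `]0, +oo[.
  by apply/seteqP; split => x /=; rewrite in_itv /= andbT.
exact: (mL measurableT).
Qed.

Lemma continuous_P1 L : isP1_on setT L -> continuous L.
Proof.
move=> [c0 [c1 [c2 LE]]].
have -> : L = (fun x => c0 + c1 * x.1 + c2 * x.2) by apply/funext => x; rewrite LE.
move=> x; apply: cvgD; [apply: cvgD; [exact: cvg_cst|]|];
  apply: cvgM; try exact: cvg_cst; [exact: cvg_fst|exact: cvg_snd].
Qed.

Lemma open_P1_gt0 L : isP1_on setT L -> open [set x | 0 < L x].
Proof.
move=> /continuous_P1 cL; apply: (@open_comp _ _ L [set y | 0 < y]); last exact: open_gt.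
by move=> x _; exact: cL.
Qed.

(** The zero set is a line or empty. If [c2] is nonzero, each vertical section is a single point; if
    only [c1] is nonzero, the set is a vertical line; a constant [L] has no zero because of [p]. *)
Lemma null_P1_eq0 L p : isP1_on setT L -> L p != 0 ->
  leb2 ([set x | L x = 0] : set mpt) = 0%E.
Proof.
move=> L1 Lp; have mA := measurable_P1_eq0 L1; move: L1 => [c0 [c1 [c2 LE]]].
have {}LE x : L x = c0 + c1 * x.1 + c2 * x.2 by rewrite LE.
have [c20|c20] := eqVneq c2 0; last first.
  rewrite /leb2 /product_measure1 /=.
  under eq_integral => x _.
    rewrite (_ : xsection _ x = [set - (c0 + c1 * x) / c2]); last first.
      apply/seteqP; split => y; rewrite /xsection /= inE /= LE /= => h.
        by apply: (mulIf c20); rewrite mulfVK//; lra.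
      by rewrite h; field.
    rewrite /leb lebesgue_measure_set1.
    over.
  by rewrite integral0.
have [c10|c10] := eqVneq c1 0.
  rewrite (_ : [set x | L x = 0] = set0) ?measure0//.
  apply/seteqP; split => // x /=; rewrite LE c10 c20 !mul0r !addr0 => c00.
  by move: Lp; rewrite LE c10 c20 !mul0r !addr0 c00 eqxx.
rewrite (_ : [set x | L x = 0] = [set - c0 / c1] `*` setT).
  have -> : leb2 ([set - c0 / c1] `*` setT : set mpt) = (leb [set (- c0 / c1)%R] * leb setT)%E.
    by apply: product_measure1E => //; exact: (measurable_set1 (- c0 / c1)).
  (* The vertical direction has infinite measure; the product is 0 by the convention that zero times
     infinity is zero. *)
  by rewrite /leb /= lebesgue_measure_set1 mul0e.
apply/seteqP; split => x /=; rewrite LE c20 mul0r addr0 => h.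
  by split=> //; apply: (mulIf c10); rewrite mulfVK//; lra.
by rewrite h.1; field.
Qed.

End affine.

(** * Barycentric coordinates and the Clough-Tocher split of one triangle *)

Section triangles.
Variable R : realType.
Implicit Types (x p : pt R) (T K : tri R) (s Th : seq (tri R)).

Notation mpt := (measurableTypeR R * measurableTypeR R)%type.

Definition cross (u w : pt R) : R := u.1 * w.2 - u.2 * w.1.
(** Barycentric coordinates by Cramer's rule; [lamA] is the complement, so the three sum to 1 by
    definition. *)
Definition lamB T x := cross (psub x (tA T)) (psub (tC T) (tA T)) / det2 T.
Definition lamC T x := cross (psub (tB T) (tA T)) (psub x (tA T)) / det2 T.
Definition lamA T x := 1 - lamB T x - lamC T x.

Definition bary T (a b c : R) : pt R :=
  padd (pscale a (tA T)) (padd (pscale b (tB T)) (pscale c (tC T))).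

Lemma baryK T x : det2 T != 0 -> bary T (lamA T x) (lamB T x) (lamC T x) = x.
Proof.
case: T => [[[a1 a2] [b1 b2]] [c1 c2]]; case: x => x1 x2.
rewrite /bary /lamA /lamB /lamC /cross /det2 /padd /pscale /psub /= => D.
by congr pair; field.
Qed.

Lemma lamB_bary T a b c : det2 T != 0 -> a + b + c = 1 -> lamB T (bary T a b c) = b.
Proof.
case: T => [[[a1 a2] [b1 b2]] [c1 c2]].
rewrite /bary /lamB /cross /det2 /padd /pscale /psub /= => D abc.
have -> : a = 1 - b - c by lra.
by field.
Qed.

Lemma lamC_bary T a b c : det2 T != 0 -> a + b + c = 1 -> lamC T (bary T a b c) = c.
Proof.
case: T => [[[a1 a2] [b1 b2]] [c1 c2]].
rewrite /bary /lamC /cross /det2 /padd /pscale /psub /= => D abc.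
have -> : a = 1 - b - c by lra.
by field.
Qed.

Lemma lamA_bary T a b c : det2 T != 0 -> a + b + c = 1 -> lamA T (bary T a b c) = a.
Proof. by move=> D abc; rewrite /lamA lamB_bary// lamC_bary//; lra. Qed.

Lemma P1_sub (L L' : pt R -> R) : isP1_on setT L -> isP1_on setT L' ->
  isP1_on setT (fun x => L x - L' x).
Proof.
move=> [c0 [c1 [c2 LE]]] [d0 [d1 [d2 LE']]].
exists (c0 - d0), (c1 - d1), (c2 - d2) => x _; rewrite LE// LE'//; ring.
Qed.

Lemma P1_cst (c : R) : isP1_on setT (fun=> c : R).
Proof. by exists c, 0, 0 => x _; ring. Qed.

Lemma P1_lamB T : isP1_on setT (lamB T).
Proof.
case: T => [[[a1 a2] [b1 b2]] [c1 c2]]; set T := (_, _, _).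
exists ((- a1 * (c2 - a2) + a2 * (c1 - a1)) / det2 T), ((c2 - a2) / det2 T),
  (- (c1 - a1) / det2 T).
by move=> [x1 x2] _; rewrite /lamB /cross /psub /=; ring.
Qed.

Lemma P1_lamC T : isP1_on setT (lamC T).
Proof.
case: T => [[[a1 a2] [b1 b2]] [c1 c2]]; set T := (_, _, _).
exists ((- (b1 - a1) * a2 + (b2 - a2) * a1) / det2 T), (- (b2 - a2) / det2 T),
  ((b1 - a1) / det2 T).
by move=> [x1 x2] _; rewrite /lamC /cross /psub /=; ring.
Qed.

Lemma P1_lamA T : isP1_on setT (lamA T).
Proof.
by apply: P1_sub; [apply: P1_sub; [exact: P1_cst|exact: P1_lamB]|exact: P1_lamC].
Qed.

(** Replaces the existential weights by strict affine inequalities, from which openness and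
    measurability can be read off. *)
Lemma otriE T : det2 T != 0 ->
  otri T = [set x | 0 < lamA T x] `&` [set x | 0 < lamB T x] `&` [set x | 0 < lamC T x].
Proof.
move=> D; apply/seteqP; split => x /=.
  move=> [a [b [c [a0 [b0 [c0 [abc ->]]]]]]].
  by rewrite -/(bary T a b c) lamA_bary// lamB_bary// lamC_bary.
move=> [[a0 b0] c0]; exists (lamA T x), (lamB T x), (lamC T x).
by do 3!split=> //; split; [rewrite /lamA; ring|rewrite -[LHS](baryK x D)].
Qed.

Lemma open_otri T : det2 T != 0 -> open (otri T).
Proof.
move=> D; rewrite otriE//.
by do 2?[apply: openI]; apply: open_P1_gt0;
  [exact: P1_lamA|exact: P1_lamB|exact: P1_lamC].
Qed.

Lemma measurable_otri T : det2 T != 0 -> measurable (otri T : set mpt).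
Proof.
move=> D; rewrite otriE//.
by do 2?[apply: measurableI]; apply: measurable_P1_gt0;
  [exact: P1_lamA|exact: P1_lamB|exact: P1_lamC].
Qed.

Lemma vertices_neq T : det2 T != 0 ->
  [/\ tA T != tB T, tB T != tC T & tA T != tC T].
Proof.
case: T => [[A B] C] D; split; rewrite /tA /tB /tC /=; apply: contraNneq D => ->;
  by rewrite /det2 /psub /=; apply/eqP; ring.
Qed.

Lemma bary_ctri T a b c : det2 T != 0 -> 0 <= a -> 0 <= b -> 0 <= c ->
  a + b + c = 1 -> ctri T (bary T a b c).
Proof.
move=> /vertices_neq[AB BC AC] a0 b0 c0 abc.
(* The weights in [conv] depend on the point and not on its position in the list, so three
   prescribed weights require distinct vertices. *)
exists (fun p => if p == tA T then a else if p == tB T then b else c).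
split; first by move=> p _; do 2?case: ifP.
rewrite /verts !big_cons !big_nil !eqxx [tB T == _]eq_sym (negbTE AB).
rewrite [tC T == tA T]eq_sym (negbTE AC) [tC T == tB T]eq_sym (negbTE BC).
by split; [rewrite -abc; ring|rewrite !addr0].
Qed.

Lemma ctri_bary T x : ctri T x ->
  exists a b c : R, [/\ 0 <= a, 0 <= b, 0 <= c, a + b + c = 1 & x = bary T a b c].
Proof.
move=> [lam [lam0 [lam1 ->]]].
exists (lam (tA T)), (lam (tB T)), (lam (tC T)).
split; try by apply: lam0; rewrite !inE eqxx ?orbT.
  by rewrite -lam1 /verts !big_cons big_nil addr0 addrA.
by rewrite /verts !big_cons !big_nil !addr0.
Qed.

Lemma otri_ctri T : det2 T != 0 -> otri T `<=` ctri T.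
Proof.
move=> D x [a [b [c [a0 [b0 [c0 [abc ->]]]]]]].
by apply: (@bary_ctri T a b c) => //; exact: ltW.
Qed.

(** The barycenter cuts [T] into three subtriangles of the same orientation, each with a third of
    the area. *)
Lemma det2_ct_split T K : det2 T != 0 -> K \in ct_split T -> det2 K != 0.
Proof.
move=> D; suff : det2 K = det2 T / 3 \/ K \notin ct_split T.
  by move=> [->|/negP//] _; rewrite mulf_neq0// invr_eq0 pnatr_eq0.
have [|] := boolP (K \in ct_split T); [left|by right].
case: T {D} p => [[[a1 a2] [b1 b2]] [c1 c2]]; rewrite !inE => /or3P[] /eqP ->;
  by rewrite /det2 /barycenter /psub /pscale /padd /=; field.
Qed.

Lemma ctri_ct_split T K : det2 T != 0 -> K \in ct_split T -> ctri K `<=` ctri T.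
Proof.
move=> D KT x /ctri_bary[a [b [c [a0 b0 c0 abc ->]]]].
(* The weight [c] of the barycenter is shared equally among the three vertices of [T]. *)
have c3 : 0 <= c / 3 by rewrite divr_ge0.
have {KT} : bary K a b c = bary T (a + c / 3) (b + c / 3) (c / 3) \/
   bary K a b c = bary T (c / 3) (a + c / 3) (b + c / 3) \/
   bary K a b c = bary T (b + c / 3) (c / 3) (a + c / 3).
  move: KT; rewrite !inE => /or3P[] /eqP ->; [left|right;left|right;right];
  by rewrite /bary /barycenter /pscale /padd /=; congr pair; field.
by move=> [->|[->|->]]; apply: bary_ctri; rewrite ?addr_ge0//; lra.
Qed.

(* The medians of [T] together with its edge lines: they contain all edges of the
   Clough-Tocher subtriangles of [T]. *)
Definition ct_skeleton T : set (pt R) :=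
  [set x | lamA T x = 0] `|` [set x | lamB T x = 0] `|` [set x | lamC T x = 0] `|`
  ([set x | lamA T x - lamB T x = 0] `|` [set x | lamB T x - lamC T x = 0] `|`
   [set x | lamC T x - lamA T x = 0]).

(** Off the skeleton the coordinates are positive and pairwise distinct, so one of them is strictly
    smallest. The point then lies in the subtriangle on the opposite edge: subtracting the minimum
    from the other two coordinates leaves three times the minimum for the barycenter. *)
Lemma ctri_setD_otri T x : det2 T != 0 -> ctri T x ->
  ct_skeleton T x \/ exists2 K, K \in ct_split T & otri K x.
Proof.
move=> D /ctri_bary[a [b [c [a0 b0 c0 abc xE]]]].
have [?|S] := pselect (ct_skeleton T x); [by left|right].
move: S; rewrite /ct_skeleton /= xE lamA_bary// lamB_bary// lamC_bary//.
move=> /not_orP[/not_orP[/not_orP[/eqP an0 /eqP bn0] /eqP cn0]].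
move=> /not_orP[/not_orP[/eqP ab /eqP bc] /eqP ca].
have {}a0 : 0 < a by rewrite lt_neqAle eq_sym an0.
have {}b0 : 0 < b by rewrite lt_neqAle eq_sym bn0.
have {}c0 : 0 < c by rewrite lt_neqAle eq_sym cn0.
rewrite !subr_eq0 in ab bc ca.
have [[ac bc']|[[ba ca']|[ab' cb]]] :
  (c < a /\ c < b) \/ (a < b /\ a < c) \/ (b < a /\ b < c).
  move: ab bc ca; rewrite !neq_lt => /orP[] ? /orP[] ? /orP[] ?; lra.
- exists (tA T, tB T, barycenter T); first by rewrite !inE eqxx.
  exists (a - c), (b - c), (3 * c); do 3!(split; first by lra); split; first by lra.
  by rewrite /bary /barycenter /pscale /padd /=; congr pair; field.
- exists (tB T, tC T, barycenter T); first by rewrite !inE eqxx orbT.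
  exists (b - a), (c - a), (3 * a); do 3!(split; first by lra); split; first by lra.
  by rewrite /bary /barycenter /pscale /padd /=; congr pair; field.
- exists (tC T, tA T, barycenter T); first by rewrite !inE eqxx !orbT.
  exists (c - b), (a - b), (3 * b); do 3!(split; first by lra); split; first by lra.
  by rewrite /bary /barycenter /pscale /padd /=; congr pair; field.
Qed.

Lemma measurable_ct_skeleton T : measurable (ct_skeleton T : set mpt).
Proof.
have hA := P1_lamA T; have hB := P1_lamB T; have hC := P1_lamC T.
by do !apply: measurableU; apply: measurable_P1_eq0 => //; exact: P1_sub.
Qed.

(** Each of the six affine functions takes the value 1 or -1 at some vertex of [T], hence
    [null_P1_eq0] applies to each. *)
Lemma null_ct_skeleton T : det2 T != 0 -> leb2 (ct_skeleton T) = 0%E.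
Proof.
move=> D.
have hA := P1_lamA T; have hB := P1_lamB T; have hC := P1_lamC T.
have lam100 := conj (lamA_bary (T := T) (a:=1) (b:=0) (c:=0) D)
   (conj (lamB_bary (T := T) (a:=1) (b:=0) (c:=0) D) (lamC_bary (T := T) (a:=1) (b:=0) (c:=0) D)).
have lam010 := conj (lamB_bary (T := T) (a:=0) (b:=1) (c:=0) D) (lamC_bary (T := T) (a:=0) (b:=1) (c:=0) D).
have lam001 := (lamC_bary (T := T) (a:=0) (b:=0) (c:=1) D).
have N L p : isP1_on setT L -> L p != 0 -> (@leb2 R).-negligible [set x | L x = 0].
  move=> L1 Lp; exists [set x | L x = 0]; split => //.
    exact: measurable_P1_eq0.
  exact: null_P1_eq0 Lp.
apply/negligibleP; first exact: measurable_ct_skeleton.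
do !apply: negligibleU.
- by apply: (N _ (bary T 1 0 0)) => //; rewrite lam100.1 ?oner_eq0//; ring.
- by apply: (N _ (bary T 0 1 0)) => //; rewrite lam010.1 ?oner_eq0//; ring.
- by apply: (N _ (bary T 0 0 1)) => //; rewrite lam001 ?oner_eq0//; ring.
- apply: (N _ (bary T 1 0 0)); first exact: P1_sub.
  by rewrite lam100.1 ?lam100.2.1 ?subr0 ?oner_eq0//; ring.
- apply: (N _ (bary T 0 1 0)); first exact: P1_sub.
  by rewrite lam010.1 ?lam010.2 ?subr0 ?oner_eq0//; ring.
- apply: (N _ (bary T 1 0 0)); first exact: P1_sub.
  by rewrite lam100.1 ?lam100.2.2 ?sub0r ?oppr_eq0 ?oner_eq0//; ring.
Qed.

End triangles.

(** * Integration over the mesh domain and derivatives of piecewise polynomials *)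

Section meshes.
Variable R : realType.
Implicit Types (x p : pt R) (T K : tri R) (s Th : seq (tri R)) (f g : pt R -> R).

Notation mpt := (measurableTypeR R * measurableTypeR R)%type.

Definition nondegenerate s := forall T, T \in s -> det2 T != 0.
(** For [s = ct_refine Th] this replaces [Omegah Th] as domain of integration: near each of its
    points a piecewise polynomial is a single polynomial. *)
Definition otris s : set (pt R) := [set x | exists2 K, K \in s & otri K x].

Lemma otris_nil : otris [::] = set0.
Proof. by apply/seteqP; split => // x []. Qed.

Lemma otris_cons K s : otris (K :: s) = otri K `|` otris s.
Proof.
apply/seteqP; split => x /=.
  by move=> [K']; rewrite inE => /predU1P[->|K's] xK'; [left|right; exists K'].
by move=> [xK|[K' K's xK']]; [exists K; rewrite ?mem_head|exists K'; rewrite // inE K's orbT].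
Qed.

Lemma nondegenerate_cons K s : nondegenerate (K :: s) -> det2 K != 0 /\ nondegenerate s.
Proof.
by move=> D; split=> [|T Ts]; apply: D; rewrite inE ?eqxx// Ts orbT.
Qed.

Lemma nondegenerate_ct_refine Th : nondegenerate Th -> nondegenerate (ct_refine Th).
Proof.
move=> D K /flatten_mapP[T TTh KT]; exact: det2_ct_split (D _ TTh) KT.
Qed.

Lemma open_otris s : nondegenerate s -> open (otris s).
Proof.
elim: s => [_|K s IH /nondegenerate_cons[DK Ds]]; first by rewrite otris_nil; exact: open0.
by rewrite otris_cons; apply: openU; [exact: open_otri|exact: IH].
Qed.

Lemma measurable_otris s : nondegenerate s -> measurable (otris s : set mpt).
Proof.
elim: s => [_|K s IH /nondegenerate_cons[DK Ds]]; first by rewrite otris_nil.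
by rewrite otris_cons; apply: measurableU; [exact: measurable_otri|exact: IH].
Qed.

Definition vbound T : R := `|(tA T).1| + `|(tA T).2| + (`|(tB T).1| + `|(tB T).2|) +
  (`|(tC T).1| + `|(tC T).2|).

Lemma otri_bound T x : otri T x -> `|x.1| <= vbound T /\ `|x.2| <= vbound T.
Proof.
move=> [a [b [c [a0 [b0 [c0 [abc ->]]]]]]]; rewrite /padd /pscale /=.
have H (u v w : R) : `|a * u + (b * v + c * w)| <= `|u| + `|v| + `|w|.
  rewrite -addrA (le_trans (ler_normD _ _))// lerD//.
    by rewrite normrM gtr0_norm// ler_piMl//; lra.
  rewrite (le_trans (ler_normD _ _))// lerD// normrM gtr0_norm// ler_piMl//; lra.
split; apply: le_trans (H _ _ _) _; rewrite /vbound.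
  rewrite -!addrA lerD// -[leLHS]add0r lerD// lerD// -[leLHS]add0r lerD//.
  by rewrite lerDl.
rewrite -[leLHS]add0r -!addrA lerD// lerD// -[leLHS]add0r lerD// lerD//.
by rewrite -[leLHS]add0r lerD.
Qed.

(** The triangle fits into a square whose half side is [vbound T]. *)
Lemma leb2_otri_lty T : det2 T != 0 -> (leb2 (otri T) < +oo)%E.
Proof.
move=> D; set M := vbound T.
have mI : measurable (`[- M, M]%classic : set (measurableTypeR R)) by exact: measurable_itv.
have leI : (leb `[(- M)%R, M]%classic < +oo)%E.
  by rewrite /leb lebesgue_measure_itv /=; case: ifP => _; rewrite ?ltry.
apply: (@le_lt_trans _ _ (leb2 (`[- M, M]%classic `*` `[- M, M]%classic))).
  apply: le_measure; rewrite ?inE.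
  - exact: measurable_otri.
  - exact: measurableX.
  - by move=> x /otri_bound; rewrite !ler_norml.
have -> : leb2 (`[- M, M]%classic `*` `[- M, M]%classic : set mpt)
   = (leb `[(- M)%R, M]%classic * leb `[(- M)%R, M]%classic)%E.
  exact: product_measure1E.
by rewrite lte_mul_pinfty// ge0_fin_numE.
Qed.

Lemma leb2_otris_lty s : nondegenerate s -> (leb2 (otris s) < +oo)%E.
Proof.
elim: s => [_|K s IH /nondegenerate_cons[DK Ds]].
  by rewrite otris_nil [X in (X < _)%E]measure0.
rewrite otris_cons; have H : (leb2 (otri K) + leb2 (otris s) < +oo)%E.
  by apply: lte_add_pinfty; [exact: leb2_otri_lty|exact: IH].
apply: le_lt_trans H; apply: measureU2.
  exact: measurable_otri.
exact: measurable_otris.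
Qed.

Lemma bmeas_otris s f : nondegenerate s ->
  (forall K, K \in s -> bmeas (otri K : set mpt) f) -> bmeas (otris s : set mpt) f.
Proof.
elim: s => [_ _|K s IH /nondegenerate_cons[DK Ds] Hf].
  by rewrite otris_nil; exact: bmeas_set0.
rewrite otris_cons; apply: bmeasU.
- exact: measurable_otri.
- exact: measurable_otris.
- by apply: Hf; rewrite mem_head.
- by apply: IH => // K' K's; apply: Hf; rewrite inE K's orbT.
Qed.

Lemma bmeas_P1 K f : isP1_on (otri K) f -> bmeas (otri K : set mpt) f.
Proof.
move=> [c0 [c1 [c2 fE]]].
apply: (@bmeas_eq _ mpt _ _ (fun x => c0 + c1 * x.1 + c2 * x.2)).
  by move=> x Kx; rewrite fE.
apply: bmeasD; [apply: bmeasD; [exact: bmeas_cst|]|];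
  (apply: bmeasM; first exact: bmeas_cst); split.
- by apply: measurable_funTS; exact: measurable_fst.
- by exists (vbound K) => x /otri_bound[].
- by apply: measurable_funTS; exact: measurable_snd.
- by exists (vbound K) => x /otri_bound[].
Qed.

Lemma otris_region Th : nondegenerate Th -> otris (ct_refine Th) `<=` region Th.
Proof.
move=> D x [K /flatten_mapP[T TTh KT] xK]; exists T => //.
apply: (ctri_ct_split (D _ TTh) KT); apply: otri_ctri xK.
exact: det2_ct_split (D _ TTh) KT.
Qed.

(** An open subset of the region is contained in its interior. *)
Lemma otris_Omegah Th : nondegenerate Th -> otris (ct_refine Th) `<=` Omegah Th.
Proof.
move=> D; rewrite /Omegah -open_subsetE; last exact/open_otris/nondegenerate_ct_refine.
exact: otris_region.
Qed.

(** What the open subtriangles miss lies in the finite union of the skeletons. *)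
Lemma negligible_region_setD_otris Th : nondegenerate Th ->
  (@leb2 R).-negligible (region Th `\` otris (ct_refine Th)).
Proof.
move=> D; pose S s : set mpt := [set x | exists2 T, T \in s & ct_skeleton T x].
apply: (@negligibleS _ _ _ _ (S Th)).
  move=> x [[T /= TTh xT] xU].
  have [xS|[K KT xK]] := ctri_setD_otri (D _ TTh) xT; first by exists T.
  by exfalso; apply: xU; exists K => //; apply/flatten_mapP; exists T.
elim: Th D => [_|T Th IH /nondegenerate_cons[DT DTh]].
  by rewrite (_ : S _ = set0); [exact: negligible_set0|apply/seteqP; split => // x []].
have sS : S (T :: Th) `<=` ct_skeleton T `|` S Th.
  by move=> x [T']; rewrite inE => /predU1P[->|T's] xT'; [left|right; exists T'].
apply: (negligibleS sS); apply: negligibleU; last exact: IH.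
exists (ct_skeleton T); split => //; first exact: measurable_ct_skeleton.
exact: null_ct_skeleton.
Qed.

(** Stated for every [f] so that it applies to [divv] and [gradsq], whose values off the open
    subtriangles are not known. *)
Lemma intOhE Th f : nondegenerate Th ->
  intOh Th f = (\int[@leb2 R]_(x in otris (ct_refine Th)) f x)%R.
Proof.
move=> D; have [N [mN N0 sN]] := negligible_region_setD_otris D.
have sNO : Omegah Th `\` otris (ct_refine Th) `<=` N.
  by apply: subset_trans sN => x [/interior_subset xR xU].
exact (@Rintegral_off_null _ _ _ (@leb2 R) _ _ f _ mN N0 (otris_Omegah D) sNO).
Qed.

(** The derivative depends only on the values near [t], and a mesh function agrees with a given
    polynomial only locally. *)
Lemma derive1_near_quad (h : R -> R) (a b c t : R) :
  (\forall u \near t, a + b * u + c * u ^+ 2 = h u) ->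
  derive1 h t = b + 2 * c * t.
Proof.
move=> H; rewrite derive1E -(near_eq_derive _ H).
(* In terms of [cst] and [id], the derivative can be inferred from the structure of the
   expression. *)
have -> : (fun u => a + b * u + c * u ^+ 2) =
  (cst a + cst b * id + cst c * (id ^+ 2)) :> (R -> R) by apply/funext.
rewrite derive_val.
rewrite /GRing.scale /=.
ring.
Qed.

(** On an open triangle the difference quotients see only the polynomial. The last two conclusions
    prepare the passage from a test function to its opposite. *)
Lemma P2_partials K g : det2 K != 0 -> isP2_on (otri K) g ->
  [/\ isP1_on (otri K) (d1 g), isP1_on (otri K) (d2 g),
   forall x, otri K x -> d1 (fun y => - g y) x = - d1 g x &
   forall x, otri K x -> d2 (fun y => - g y) x = - d2 g x].
Proof.
move=> D [c0 [c1 [c2 [c3 [c4 [c5 gE]]]]]].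
(* A partial derivative moves one coordinate, so openness is needed along axis-parallel lines. *)
have n1 x : otri K x -> \forall u \near x.1, otri K (u, x.2).
  case: x => x1 x2 xK; have nK := open_nbhs_nbhs (conj (open_otri D) xK).
  have cv : (fun u : R => (u, x2)) @ x1 --> (x1, x2).
    exact: (@cvg_pair _ _ _ (nbhs x1) (nbhs x1) (nbhs x2) _ _ _ id (cst x2) cvg_id (cvg_cst x2)).
  exact: (cv _ nK).
have n2 x : otri K x -> \forall u \near x.2, otri K (x.1, u).
  case: x => x1 x2 xK; have nK := open_nbhs_nbhs (conj (open_otri D) xK).
  have cv : (fun u : R => (x1, u)) @ x2 --> (x1, x2).
    exact: (@cvg_pair _ _ _ (nbhs x2) (nbhs x1) (nbhs x2) _ _ _ (cst x1) id (cvg_cst x1) cvg_id).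
  exact: (cv _ nK).
have g1 x : otri K x -> d1 g x = c1 + 2 * c3 * x.1 + c4 * x.2.
  move=> xK; rewrite /d1 (@derive1_near_quad _ (c0 + c2 * x.2 + c5 * x.2 ^+ 2) (c1 + c4 * x.2) c3); first ring.
  by near=> u; rewrite gE /=; [ring|near: u; exact: n1].
have g2 x : otri K x -> d2 g x = c2 + c4 * x.1 + 2 * c5 * x.2.
  move=> xK; rewrite /d2 (@derive1_near_quad _ (c0 + c1 * x.1 + c3 * x.1 ^+ 2) (c2 + c4 * x.1) c5); first ring.
  by near=> u; rewrite gE /=; [ring|near: u; exact: n2].
split.
- by exists c1, (2 * c3), c4.
- by exists c2, c4, (2 * c5).
- move=> x xK; rewrite g1// /d1 (@derive1_near_quad _ (- (c0 + c2 * x.2 + c5 * x.2 ^+ 2)) (- (c1 + c4 * x.2)) (- c3)); first ring.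
  by near=> u; rewrite gE /=; [ring|near: u; exact: n1].
- move=> x xK; rewrite g2// /d2 (@derive1_near_quad _ (- (c0 + c1 * x.1 + c3 * x.1 ^+ 2)) (- (c2 + c4 * x.1)) (- c5)); first ring.
  by near=> u; rewrite gE /=; [ring|near: u; exact: n2].
Unshelve. all: by end_near. Qed.

End meshes.

(** * Integrals over boundary edges *)

Section edges.
Variable R : realType.
Implicit Types (x p : pt R) (T K : tri R) (Th : seq (tri R)) (f g mu : pt R -> R)
  (v : pt R -> pt R) (e : edge R) (q : pt R -> R).

Notation I01 := (`[0, 1]%classic : set (measurableTypeR R)).

Lemma elen_ge0 e : 0 <= elen e.
Proof. exact: sqrtr_ge0. Qed.

Lemma pdot_ge0 p : 0 <= pdot p p.
Proof. by rewrite /pdot addr_ge0// -expr2 sqr_ge0. Qed.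

Lemma enorm_sqr p : enorm p ^+ 2 = pdot p p.
Proof. by rewrite sqr_sqrtr// pdot_ge0. Qed.

(* The degenerate edge, whose normal is 0, is included. *)
Lemma pdot_enormal_le1 e : pdot (enormal e) (enormal e) <= 1.
Proof.
rewrite /enormal; set d := psub _ _; set m := (_, _); set s := if _ then _ else _.
have s2 : s * s = 1 by rewrite /s; case: ifP => _; ring.
have mm : pdot m m = enorm d ^+ 2 by rewrite enorm_sqr /pdot /m /=; ring.
have -> : pdot (pscale (s / enorm d) m) (pscale (s / enorm d) m) =
  (s * s) * (pdot m m / enorm d ^+ 2).
  by rewrite /pdot /pscale /=; rewrite expr2 invfM; ring.
rewrite s2 mul1r mm; have [->|d0] := eqVneq (enorm d) 0.
  by rewrite expr0n mul0r.
by rewrite divff// expf_neq0.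
Qed.

(** Lagrange's identity: the defect in the Cauchy-Schwarz inequality of the plane is the square of
    the cross product. *)
Lemma pdot_sqr_le p n : pdot n n <= 1 -> pdot p n ^+ 2 <= pdot p p.
Proof.
move=> n1; apply: (@le_trans _ _ (pdot p p * pdot n n)).
  rewrite -subr_ge0; have -> : pdot p p * pdot n n - pdot p n ^+ 2 =
    (p.1 * n.2 - p.2 * n.1) ^+ 2 by rewrite /pdot; ring.
  exact: sqr_ge0.
by rewrite ler_piMr// pdot_ge0.
Qed.

Definition bmeas_edge e f := bmeas I01 (fun t => f (epar e t)).

Lemma leb_I01 : (leb I01 < +oo)%E.
Proof. by rewrite /leb lebesgue_measure_itv /= lte01 oppr0 adde0 ltry. Qed.

Lemma int_edge_ge0 e f : (forall x, 0 <= f x) -> 0 <= int_edge e f.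
Proof. by move=> f0; rewrite mulr_ge0// ?elen_ge0//; apply: Rintegral_ge0 => t _. Qed.

Lemma int_edgeN e f : int_edge e (fun x => - f x) = - int_edge e f.
Proof. by rewrite /int_edge RintegralN mulrN. Qed.

Lemma int_edge_eq0 e f : (forall x, closed_edge e x -> f x = 0) -> int_edge e f = 0.
Proof.
move=> f0; rewrite /int_edge (_ : Rintegral _ _ _ = 0) ?mulr0//.
rewrite (@eq_Rintegral _ _ _ _ _ (fun=> 0)); last first.
  by move=> t /set_mem tI; apply: f0; exists t.
by rewrite /Rintegral integral0.
Qed.

(** After parametrisation over the unit interval, with [l] the edge length, [w] the normal component
    of [v], [u] its squared length and [m] the value of [mu], the integrand is the sum of
    [(s w + l m)^2] and [s^2 (u - w^2)]. The weights of the two norms are inverse to each other,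
    which makes the square complete. *)
Lemma int_edge_quad_ge0 e v mu (s : R) :
  bmeas_edge e (fun x => pdot (v x) (v x)) ->
  bmeas_edge e (fun x => pdot (v x) (enormal e) * mu x) ->
  bmeas_edge e (fun x => mu x ^+ 2) ->
  0 <= s ^+ 2 * ((elen e)^-1 * int_edge e (fun x => pdot (v x) (v x)))
       + 2 * s * int_edge e (fun x => pdot (v x) (enormal e) * mu x)
       + elen e * int_edge e (fun x => mu x ^+ 2).
Proof.
move=> b1 b2 b3; have [e0|e0] := eqVneq (elen e) 0.
  by rewrite /int_edge e0 !mul0r !mulr0 !addr0.
have ep : 0 < elen e by rewrite lt_neqAle eq_sym e0 elen_ge0.
rewrite /int_edge mulKf//.
set A := Rintegral _ _ _; set B := Rintegral _ _ _; set C := Rintegral _ _ _.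
have -> : s ^+ 2 * A + 2 * s * (elen e * B) + elen e * (elen e * C) =
   s ^+ 2 * A + 2 * (elen e * s) * B + elen e ^+ 2 * C by ring.
have bc c (h : R -> R) : bmeas I01 h -> bmeas I01 (fun t => c * h t).
  by move=> bh; apply: bmeasM => //; exact: bmeas_cst.
have mI : measurable I01 by exact: measurable_itv.
have := bmeas_Rintegral_quad mI leb_I01 s b1 (bc (elen e) _ b2) (bc (elen e ^+ 2) _ b3).
rewrite !(bmeas_RintegralZ mI leb_I01)// -/A -/B -/C => H.
have -> : s ^+ 2 * A + 2 * (elen e * s) * B + elen e ^+ 2 * C =
  s ^+ 2 * A + 2 * s * (elen e * B) + elen e ^+ 2 * C by ring.
rewrite -H; apply: Rintegral_ge0 => t _.
have := pdot_sqr_le (v (epar e t)) (pdot_enormal_le1 e).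
set w := pdot _ (enormal e); set m := mu _; set u := pdot _ _ => wu.
have : s ^+ 2 * w ^+ 2 <= s ^+ 2 * u by rewrite ler_wpM2l// sqr_ge0.
have : 0 <= (s * w + elen e * m) ^+ 2 by exact: sqr_ge0.
set l := elen e; move=> h1 h2; nra.
Qed.

Lemma bmeas_edge_P2 e K g : closed_edge e `<=` ctri K -> isP2_on (ctri K) g ->
  bmeas_edge e g.
Proof.
move=> eK [c0 [c1 [c2 [c3 [c4 [c5 gE]]]]]].
apply: (@bmeas_eq _ _ _ _ (fun t => c0 + c1 * (epar e t).1 + c2 * (epar e t).2
   + c3 * (epar e t).1 ^+ 2 + c4 * ((epar e t).1 * (epar e t).2) + c5 * (epar e t).2 ^+ 2)).
  by move=> t tI; rewrite gE//; apply: eK; exists t.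
have bid : bmeas I01 (fun t => t).
  split; first exact: measurable_id.
  by exists 1 => t /=; rewrite in_itv /= => /andP[t0 t1]; rewrite ger0_norm.
have bx (a b : R) : bmeas I01 (fun t => a + t * b).
  by apply: bmeasD; [|apply: bmeasM => //]; exact: bmeas_cst.
have b1 : bmeas I01 (fun t => (epar e t).1) by exact: bx.
have b2 : bmeas I01 (fun t => (epar e t).2) by exact: bx.
have bc c (h : R -> R) : bmeas I01 h -> bmeas I01 (fun t => c * h t).
  by move=> bh; apply: bmeasM => //; exact: bmeas_cst.
apply: bmeasD; last exact/bc/bmeasX2.
apply: bmeasD; last exact/bc/bmeasM.
apply: bmeasD; last exact/bc/bmeasX2.
apply: bmeasD; last exact/bc.
by apply: bmeasD; [exact: bmeas_cst|exact/bc].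
Qed.

Lemma bmeas_edge_quad e mu : (exists c0 c1 c2 : R,
    forall t, 0 <= t <= 1 -> mu (epar e t) = c0 + c1 * t + c2 * t ^+ 2) ->
  bmeas_edge e mu.
Proof.
move=> [c0 [c1 [c2 mE]]].
have bid : bmeas I01 (fun t => t).
  split; first exact: measurable_id.
  by exists 1 => t /=; rewrite in_itv /= => /andP[t0 t1]; rewrite ger0_norm.
apply: (@bmeas_eq _ _ _ _ (fun t => c0 + c1 * t + c2 * t ^+ 2)).
  by move=> t /=; rewrite in_itv /= => tI; rewrite mE.
have bc c (h : R -> R) : bmeas I01 h -> bmeas I01 (fun t => c * h t).
  by move=> bh; apply: bmeasM => //; exact: bmeas_cst.
apply: bmeasD; last exact/bc/bmeasX2.
by apply: bmeasD; [exact: bmeas_cst|exact/bc].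
Qed.

(** The split leaves the edges of [T] whole: each is the first edge of one subtriangle, so [v] is a
    single polynomial along it. *)
Lemma bedge_ct_refine Th e : nondegenerate Th -> e \in bedges Th ->
  exists2 K, K \in ct_refine Th & closed_edge e `<=` ctri K.
Proof.
move=> D /flatten_mapP[T TTh]; rewrite mem_filter => /andP[_ eT].
have [K KT [KA KB]] : exists2 K, K \in ct_split T & e.1.1 = tA K /\ e.1.2 = tB K.
  move: eT; rewrite !inE => /or3P[] /eqP ->.
  - by exists (tA T, tB T, barycenter T); rewrite ?inE ?eqxx.
  - by exists (tB T, tC T, barycenter T); rewrite ?inE ?eqxx ?orbT.
  - by exists (tC T, tA T, barycenter T); rewrite ?inE ?eqxx ?orbT.
exists K; first by apply/flatten_mapP; exists T.
move=> x [t /=]; rewrite in_itv /= => /andP[t0 t1] <-.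
have -> : epar e t = bary K (1 - t) t 0.
  rewrite /epar KA KB /bary /padd /pscale /psub /=; congr pair; ring.
by apply: bary_ctri; [exact: det2_ct_split (D _ TTh) KT|lra|lra|lra|lra].
Qed.

End edges.

(** * Continuity of the bilinear form and comparison of the suprema *)

Section inf_sup.
Variables (R : realType) (Th : seq (tri R)).
Hypothesis Th_nondeg : nondegenerate Th.
Implicit Types (v : pt R -> pt R) (q mu : pt R -> R).

Notation mpt := (measurableTypeR R * measurableTypeR R)%type.
Notation U := (otris (ct_refine Th) : set mpt).

Definition piecewise_P2 v := forall K, K \in ct_refine Th ->
  isP2_on (ctri K) (comp1 v) /\ isP2_on (ctri K) (comp2 v).

Let ref_nondeg : nondegenerate (ct_refine Th) := nondegenerate_ct_refine Th_nondeg.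
Let mU : measurable U := measurable_otris ref_nondeg.
Let Uoo : (leb2 U < +oo)%E := leb2_otris_lty ref_nondeg.

Definition vopp v : pt R -> pt R := fun x => (- (v x).1, - (v x).2).

Lemma P2_partials_refine v K : piecewise_P2 v -> K \in ct_refine Th ->
  [/\ isP1_on (otri K) (d1 (comp1 v)), isP1_on (otri K) (d2 (comp1 v)),
      isP1_on (otri K) (d1 (comp2 v)) & isP1_on (otri K) (d2 (comp2 v))] /\
  forall x, otri K x ->
    [/\ d1 (comp1 (vopp v)) x = - d1 (comp1 v) x, d2 (comp1 (vopp v)) x = - d2 (comp1 v) x,
        d1 (comp2 (vopp v)) x = - d1 (comp2 v) x & d2 (comp2 (vopp v)) x = - d2 (comp2 v) x].
Proof.
move=> Pv KT; have DK := ref_nondeg KT; have [P1 P2] := Pv _ KT.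
have sub g : isP2_on (ctri K) g -> isP2_on (otri K) g.
  move=> [c0 [c1 [c2 [c3 [c4 [c5 gE]]]]]]; exists c0, c1, c2, c3, c4, c5 => x xK.
  by apply/gE/otri_ctri.
have [a1 a2 a3 a4] := P2_partials DK (sub _ P1).
have [b1 b2 b3 b4] := P2_partials DK (sub _ P2).
by split=> // x xK; split; [exact: a3|exact: a4|exact: b3|exact: b4].
Qed.

Lemma bmeas_divv v : piecewise_P2 v -> bmeas U (divv v).
Proof.
move=> Pv; apply: bmeas_otris => // K KT.
have [[h1 h2 h3 h4] _] := P2_partials_refine Pv KT.
by apply: bmeasD; exact: bmeas_P1.
Qed.

Lemma bmeas_gradsq v : piecewise_P2 v -> bmeas U (gradsq v).
Proof.
move=> Pv; apply: bmeas_otris => // K KT.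
have [[h1 h2 h3 h4] _] := P2_partials_refine Pv KT.
by do 3?[apply: bmeasD]; apply: bmeasX2; exact: bmeas_P1.
Qed.

(** Agreement is asked on the open subtriangles alone, where the partial derivatives of [vopp v] are
    computed. *)
Lemma intOhN f g : (forall x, U x -> g x = - f x) -> intOh Th g = - intOh Th f.
Proof.
move=> gf; rewrite !intOhE// -RintegralN; apply: eq_Rintegral => x /set_mem.
exact: gf.
Qed.

Lemma intOh_ge0 f : (forall x, 0 <= f x) -> 0 <= intOh Th f.
Proof. by move=> f0; apply: Rintegral_ge0 => x _. Qed.

Lemma gradsq_ge0 v x : 0 <= gradsq v x.
Proof. by rewrite !addr_ge0// sqr_ge0. Qed.

Lemma intOh_divv_opp v q : piecewise_P2 v ->
  intOh Th (fun x => divv (vopp v) x * q x) = - intOh Th (fun x => divv v x * q x).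
Proof.
move=> Pv; apply: intOhN => x [K KT xK].
have [_ /(_ _ xK)[h1 _ _ h4]] := P2_partials_refine Pv KT.
by rewrite /divv h1 h4; ring.
Qed.

Lemma intOh_gradsq_opp v : piecewise_P2 v ->
  intOh Th (gradsq (vopp v)) = intOh Th (gradsq v).
Proof.
move=> Pv; rewrite !(intOhE _ Th_nondeg); apply: eq_Rintegral => x /set_mem[K KT xK].
have [_ /(_ _ xK)[h1 h2 h3 h4]] := P2_partials_refine Pv KT.
by rewrite /gradsq h1 h2 h3 h4; ring.
Qed.

(** The squared divergence is at most twice [gradsq]; the larger factor 4 is a perfect square and
    gives the constant 2. *)
Lemma intOh_divv_le v q : piecewise_P2 v ->
  (forall K, K \in ct_refine Th -> isP1_on (otri K) q) ->
  `|intOh Th (fun x => divv v x * q x)| <= 2 * gradnorm Th v * L2norm Th q.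
Proof.
move=> Pv Pq.
have bd := bmeas_divv Pv; have bg := bmeas_gradsq Pv.
have bq : bmeas U q by apply: bmeas_otris => // K KT; exact/bmeas_P1/Pq.
have bg4 : bmeas U (fun x => 2 ^+ 2 * gradsq v x).
  by apply: bmeasM => //; exact: bmeas_cst.
have -> : 2 * gradnorm Th v = Num.sqrt (2 ^+ 2 * intOh Th (gradsq v)).
  by rewrite sqrtrM ?sqr_ge0// sqrtr_sqr ger0_norm.
apply: discriminant_bound.
- by rewrite mulr_ge0 ?sqr_ge0// intOh_ge0// => x; exact: gradsq_ge0.
- by apply: intOh_ge0 => x; exact: sqr_ge0.
move=> s; rewrite !intOhE//.
rewrite -(bmeas_RintegralZ mU Uoo)// -(bmeas_Rintegral_quad mU Uoo)//; last 2 first.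
- exact: bmeasM.
- exact: bmeasX2.
apply: Rintegral_ge0 => x _; rewrite /gradsq /divv.
set a := d1 (comp1 v) x; set b := d2 (comp1 v) x; set c := d1 (comp2 v) x.
set d := d2 (comp2 v) x; set k := q x.
(* A sum of squares that certifies nonnegativity of the integrand. *)
have -> : s ^+ 2 * (2 ^+ 2 * (a ^+ 2 + b ^+ 2 + c ^+ 2 + d ^+ 2)) +
  2 * s * ((a + d) * k) + k ^+ 2 =
  (s * (a + d) + k) ^+ 2 + (s * (a - d)) ^+ 2 + 2 * (s * a) ^+ 2 + 2 * (s * d) ^+ 2
  + 4 * (s * b) ^+ 2 + 4 * (s * c) ^+ 2 by ring.
by do 5?[apply: addr_ge0]; rewrite ?sqr_ge0// mulr_ge0// sqr_ge0.
Qed.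

(** The boundary part of the square of [norm1h]. *)
Definition bdsq v := int_bd_w Th (fun e => (elen e)^-1) (fun x => pdot (v x) (v x)).

Lemma bdsq_ge0 v : 0 <= bdsq v.
Proof.
apply: sumr_ge0 => e _; rewrite mulr_ge0// ?invr_ge0 ?elen_ge0//.
by apply: int_edge_ge0 => x; exact: pdot_ge0.
Qed.

(** The quadratics of the single edges are summed before the discriminant is taken, so one
    application covers both the integrals and the sum over edges. *)
Lemma flux_le v mu : piecewise_P2 v -> Xh0 Th mu ->
  `|flux Th v mu| <= Num.sqrt (bdsq v) * normm12h Th mu.
Proof.
move=> Pv [Pmu _]; apply: discriminant_bound.
- exact: bdsq_ge0.
- apply: sumr_ge0 => e _; rewrite mulr_ge0// ?elen_ge0//.
  by apply: int_edge_ge0 => x; exact: sqr_ge0.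
move=> s; rewrite /bdsq /int_bd_w /flux !mulr_sumr -!big_split /= big_seq.
apply: sumr_ge0 => e eB.
have bmu := bmeas_edge_quad (Pmu _ eB).
have [K KT eK] := bedge_ct_refine Th_nondeg eB.
have b1 := bmeas_edge_P2 eK (Pv _ KT).1; have b2 := bmeas_edge_P2 eK (Pv _ KT).2.
apply: int_edge_quad_ge0.
- by apply: bmeasD; exact: bmeasM.
- apply: bmeasM => //; apply: bmeasD; apply: bmeasM => //; exact: bmeas_cst.
- exact: bmeasX2.
Qed.

Lemma normm12h_ge0 mu : 0 <= normm12h Th mu. Proof. exact: sqrtr_ge0. Qed.
Lemma L2norm_ge0 q : 0 <= L2norm Th q. Proof. exact: sqrtr_ge0. Qed.
Lemma norm1h_ge0 v : 0 <= norm1h Th v. Proof. exact: sqrtr_ge0. Qed.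

Lemma gradnorm_le v : gradnorm Th v <= norm1h Th v.
Proof. by rewrite ler_wsqrtr// lerDl bdsq_ge0. Qed.

Lemma sqrt_bdsq_le v : Num.sqrt (bdsq v) <= norm1h Th v.
Proof. by rewrite ler_wsqrtr// lerDr; apply: intOh_ge0 => x; exact: gradsq_ge0. Qed.

Lemma flux_opp v mu : flux Th (vopp v) mu = - flux Th v mu.
Proof.
rewrite /flux -sumrN; apply: eq_bigr => e _; rewrite -int_edgeN; congr int_edge.
by apply/funext => x; rewrite /pdot /vopp /=; ring.
Qed.

Lemma norm1h_opp v : piecewise_P2 v -> norm1h Th (vopp v) = norm1h Th v.
Proof.
move=> Pv; rewrite /norm1h intOh_gradsq_opp//; congr (Num.sqrt (_ + int_bd_w _ _ _)).
by apply/funext => x; rewrite /pdot /vopp /=; ring.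
Qed.

Lemma bh_opp v q mu : piecewise_P2 v -> bh Th (vopp v) q mu = - bh Th v q mu.
Proof. by move=> Pv; rewrite /bh flux_opp intOh_divv_opp// opprD. Qed.

Lemma Vh_opp v : Vh Th v -> Vh Th (vopp v).
Proof.
move=> [Pv v0]; split.
  have N A g : isP2_on A g -> isP2_on A (fun x => - g x).
    move=> [c0 [c1 [c2 [c3 [c4 [c5 gE]]]]]].
    by exists (- c0), (- c1), (- c2), (- c3), (- c4), (- c5) => x /gE ->; ring.
  by move=> K /Pv[h1 h2]; split; exact: N.
rewrite -[RHS]oppr0 -v0 /int_bd_vn -sumrN; apply: eq_bigr => e _.
rewrite -int_edgeN; congr int_edge.
by apply/funext => x; rewrite /pdot /vopp /=; ring.
Qed.

Lemma nonzero_opp A v : nonzero_on A (0, 0) v -> nonzero_on A (0, 0) (vopp v).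
Proof.
move=> [x xA vx]; exists x => // /pair_equal_spec[/eqP + /eqP].
rewrite !oppr_eq0 => /eqP h1 /eqP h2; apply: vx.
by rewrite (surjective_pairing (v x)) h1 h2.
Qed.

Lemma ratio_le (x n M : R) : 0 <= n -> 0 <= M -> x <= n * M -> x / n <= M.
Proof.
(* For [n = 0] the quotient is 0 by convention, and [M] is nonnegative. *)
move=> n0 M0 xM; have [->|nn] := eqVneq n 0; first by rewrite invr0 mulr0.
by rewrite ler_pdivrMr 1?mulrC// lt_neqAle eq_sym nn.
Qed.

Variables (q mu : pt R -> R).
Hypotheses (Qq : Qh0 Th q) (Xmu : Xh0 Th mu).
Notation S := (sup_bh Th q mu).

Lemma bh_ratio_le_sup v : Vh Th v -> nonzero_on (Omegah Th) (0, 0) v ->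
  bh Th v q mu / norm1h Th v <= S.
Proof.
move=> Vv nv; apply: ub_le_sup; last by exists v.
(* The first summand bounds the divergence term, the second the flux; [gradnorm] and the root of
   [bdsq] are both at most [norm1h]. *)
exists (2 * L2norm Th q + normm12h Th mu) => _ [w [[Pw _] _] <-].
apply: ratio_le; rewrite ?norm1h_ge0 ?addr_ge0 ?mulr_ge0 ?L2norm_ge0 ?normm12h_ge0//.
rewrite /bh mulrDr; apply: lerD.
  rewrite (le_trans (ler_norm _))// normrN (le_trans (intOh_divv_le Pw Qq.1))//.
  by rewrite mulrA [_ * 2]mulrC ler_wpM2r ?L2norm_ge0// ler_wpM2l// gradnorm_le.
rewrite (le_trans (ler_norm _))// (le_trans (flux_le Pw Xmu))//.
by rewrite ler_wpM2r ?normm12h_ge0// sqrt_bdsq_le.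
Qed.

(** The quotients at [v] and [vopp v] are opposite, so one of them is nonnegative; without test
    functions the supremum is that of the empty set, which is 0. *)
Lemma sup_bh_ge0 : 0 <= S.
Proof.
have [[v [Vv nv]]|none] := pselect (exists v, Vh Th v /\ nonzero_on (Omegah Th) (0, 0) v).
  have h1 := bh_ratio_le_sup Vv nv.
  have := bh_ratio_le_sup (Vh_opp Vv) (nonzero_opp nv).
  by rewrite bh_opp ?norm1h_opp ?mulNr; [lra|exact: Vv.1|exact: Vv.1].
rewrite /sup_bh; set E := image _ _; rewrite (_ : E = set0) ?sup0//.
by apply/seteqP; split => // r [v Hv _]; apply: none; exists v.
Qed.

Lemma sup_div_le_sup_bh : sup_div Th q <= S.
Proof.
rewrite /sup_div; set E := image _ _.
(* The mesh may carry no nonzero test function; the left side is then 0. *)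
have [->|/set0P E0] := eqVneq E set0; first by rewrite sup0 sup_bh_ge0.
apply: ge_sup => // _ [v [[Vv v0] nv] <-].
have := bh_ratio_le_sup (Vh_opp Vv) (nonzero_opp nv).
rewrite bh_opp ?norm1h_opp; [|exact: Vv.1|exact: Vv.1].
(* The edge terms vanish with [v], so the two norms in the denominators coincide and no constant is
   lost. *)
have -> : norm1h Th v = gradnorm Th v.
  rewrite /norm1h /gradnorm; congr Num.sqrt.
  rewrite /int_bd_w big_seq big1 ?addr0// => e eB.
  by rewrite int_edge_eq0 ?mulr0// => x /(v0 _ eB) ->; rewrite /pdot /= !mul0r addr0.
rewrite /bh (_ : flux Th v mu = 0) ?addr0 ?opprK//.
rewrite /flux big_seq big1// => e eB.
by rewrite int_edge_eq0// => x /(v0 _ eB) ->; rewrite /pdot /= !mul0r addr0 mul0r.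
Qed.

Lemma sup_bd_le_sup_bh : sup_bd Th mu <= S + 2 * L2norm Th q.
Proof.
have S0 := sup_bh_ge0; have q0 := L2norm_ge0 q.
rewrite /sup_bd; set E := image _ _.
have [->|/set0P E0] := eqVneq E set0; first by rewrite sup0 addr_ge0// mulr_ge0.
apply: ge_sup => // _ [v [Vv nv] <-].
(* The flux quotient is the quotient of [bh] plus that of the divergence term, and the latter is
   bounded next. *)
have := bh_ratio_le_sup Vv nv; rewrite /bh mulrDl.
have : intOh Th (fun x => divv v x * q x) / norm1h Th v <= 2 * L2norm Th q.
  apply: ratio_le; rewrite ?norm1h_ge0 ?mulr_ge0//.
  rewrite (le_trans (ler_norm _))// (le_trans (intOh_divv_le Vv.1 Qq.1))//.
  by rewrite mulrA [_ * 2]mulrC ler_wpM2r// ler_wpM2l// gradnorm_le.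
rewrite mulNr; lra.
Qed.

End inf_sup.

Theorem theorem4p8 (R : realType) (beta1 beta2 : R) :
  0 < beta1 -> 0 < beta2 ->
  exists2 beta : R, 0 < beta &
  forall (Om : set (pt R)) (H : set R) (Sh : R -> seq (tri R)) (h0 : R),
    smooth_domain Om -> admissible_family Om H Sh -> 0 < h0 ->
    (forall h, H h -> h <= h0 -> forall q, Qh0 (Th_of Om (Sh h)) q ->
        sup_div (Th_of Om (Sh h)) q >= beta1 * L2norm (Th_of Om (Sh h)) q) ->
    (forall h, H h -> h <= h0 -> forall mu, Xh0 (Th_of Om (Sh h)) mu ->
        sup_bd (Th_of Om (Sh h)) mu >= beta2 * normm12h (Th_of Om (Sh h)) mu) ->
    forall h, H h -> h <= h0 -> forall q mu,
      Qh0 (Th_of Om (Sh h)) q -> Xh0 (Th_of Om (Sh h)) mu ->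
      beta * normQX (Th_of Om (Sh h)) q mu <= sup_bh (Th_of Om (Sh h)) q mu.
Proof.
move=> b1 b2; exists (beta1 * beta2 / (beta1 + beta2 + 2)).
  by rewrite divr_gt0 ?mulr_gt0 ?addr_gt0.
move=> Om H Sh h0 _ [_ [adm _]] _ infsup_div infsup_bd h Hh hh0 q mu Qq Xmu.
have D : nondegenerate (Th_of Om (Sh h)).
  have [_ [[_ [D _]] _]] := adm _ Hh.
  by move=> T; rewrite mem_filter => /andP[_ /D].
have h1 := le_trans (infsup_div h Hh hh0 q Qq) (sup_div_le_sup_bh D Qq Xmu).
have h2 := le_trans (infsup_bd h Hh hh0 mu Xmu) (sup_bd_le_sup_bh D Qq Xmu).
rewrite mulrAC ler_pdivrMr ?addr_gt0// /normQX.
have := L2norm_ge0 (Th_of Om (Sh h)) q.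
move: h1 h2; set S := sup_bh _ _ _; set a := L2norm _ _; set b := normm12h _ _.
move=> h1 h2 a0.
(* The sum of this and the next inequality bounds [beta1 * beta2 * (a + b)] by
   [(beta1 + beta2) * S + 2 * beta1 * a]. By [h1] the last term is at most [2 * S], which explains
   the denominator of the constant. *)
have : beta2 * (beta1 * a) <= beta2 * S by rewrite ler_wpM2l// ltW.
have : beta1 * (beta2 * b) <= beta1 * (S + 2 * a) by rewrite ler_wpM2l// ltW.
lra.
Qed.
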